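(* Let $B$ be a finite set with $k\ge 2$ elements equipped with operators $t_1,\dots,t_s$, and let $H\subset B$ be a bearing subspace of $B$. Let $n,m\ge 1$ and $\mathcal{X}|_H:=\{(X_1,\dots,X_n)\in B^n\mid X_i\in H,\ i\in[1,n]\}$. Then $\mathcal{X}|_H$ is a state invariant subspace of every $k$-valued network $X_i(t+1)=f_i(X_1(t),\dots,X_n(t))$, $i\in[1,n]$, having bearing space $B$, and it is a state control-invariant subspace of every $k$-valued control network $X_i(t+1)=f_i(X_1(t),\dots,X_n(t),U_1(t),\dots,U_m(t))$, $i\in[1,n]$, having bearing space $B$. In particular $\mathcal{X}|_H$ does not depend on the particular network (it is called the universal state invariant subspace corresponding to $H$).
   Context: $[1,n]=\{1,\dots,n\}$. Bearing space: a network has bearing space $B$ with operators $t_1,\dots,t_s$ (finitary operations on $B$) if its state and control variables take values in $B$ and its update functions $f_i$ are built by composing the operators $t_1,\dots,t_s$ and the variables (e.g. $B$ a finite ring with its addition and multiplication, or a finite lattice with $\vee,\wedge$). Bearing subspace: a (nonempty) subset $H\subset B$ such that the restrictions $t_i|_H$ are properly defined for all $i$, i.e. $H$ is closed under every $t_i$ (a subuniverse of the universal algebra $B$). A subset $V\subset B^n$ is a state invariant subspace of a network if $X(0)\in V$ implies $X(t)\in V$ for all $t\ge0$. It is a state control-invariant subspace of a control network if for every $X(0)\in V$ there is a control sequence $\{U(t)\in B^m\mid t\ge0\}$ such that the resulting trajectory satisfies $X(t)\in V$ for all $t\ge 0$. *)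

(* Defs.v *)
From mathcomp Require Import all_boot.

Set Implicit Arguments.
Unset Strict Implicit.
Unset Printing Implicit Defensive.

(* Formal compositions of operators t_i of arity [ar i], i < s, and of variables
   in W.  Arity 0 is allowed; since there is no other constructor for constants,
   elements of B only occur in a term as nullary operators. *)
Inductive term (s : nat) (ar : 'I_s -> nat) (W : Type) : Type :=
| Var (w : W)
| App (i : 'I_s) (args : 'I_(ar i) -> term ar W).

Section BearingSpace.

Variables (B : finType) (s : nat) (ar : 'I_s -> nat).
Variable t : forall i : 'I_s, {ffun 'I_(ar i) -> B} -> B.

Fixpoint eval (W : Type) (x : W -> B) (e : term ar W) : B :=
  match e with
  | Var w => x w
  | App i args => t [ffun j => eval x (args j)]
  end.

Definition bearing_subspace (H : {set B}) : Prop :=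
  H != set0 /\
  forall (i : 'I_s) (a : {ffun 'I_(ar i) -> B}),
    (forall j, a j \in H) -> t a \in H.

(* Update functions are functions, not terms: f_i is only required to be the
   function denoted by some term. *)
Definition network_has_bearing_space (n : nat)
    (f : 'I_n -> {ffun 'I_n -> B} -> B) : Prop :=
  forall i, exists e : term ar 'I_n, forall X, f i X = eval X e.

Definition control_network_has_bearing_space (n m : nat)
    (f : 'I_n -> {ffun 'I_n -> B} -> {ffun 'I_m -> B} -> B) : Prop :=
  forall i, exists e : term ar ('I_n + 'I_m), forall X U,
    f i X U = eval (fun w => match w with inl j => X j | inr l => U l end) e.

End BearingSpace.

Section Dynamics.

Variables (B : finType) (n m : nat).

Fixpoint trajectory (f : 'I_n -> {ffun 'I_n -> B} -> B)
    (X0 : {ffun 'I_n -> B}) (T : nat) : {ffun 'I_n -> B} :=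
  if T is T'.+1 then [ffun i => f i (trajectory f X0 T')] else X0.

Fixpoint control_trajectory
    (f : 'I_n -> {ffun 'I_n -> B} -> {ffun 'I_m -> B} -> B)
    (U : nat -> {ffun 'I_m -> B})
    (X0 : {ffun 'I_n -> B}) (T : nat) : {ffun 'I_n -> B} :=
  if T is T'.+1 then [ffun i => f i (control_trajectory f U X0 T') (U T')]
  else X0.

Definition state_invariant (f : 'I_n -> {ffun 'I_n -> B} -> B)
    (V : {set {ffun 'I_n -> B}}) : Prop :=
  forall X0, X0 \in V -> forall T, trajectory f X0 T \in V.

Definition state_control_invariant
    (f : 'I_n -> {ffun 'I_n -> B} -> {ffun 'I_m -> B} -> B)
    (V : {set {ffun 'I_n -> B}}) : Prop :=
  forall X0, X0 \in V ->
    exists U : nat -> {ffun 'I_m -> B},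
      forall T, control_trajectory f U X0 T \in V.

End Dynamics.

Definition restricted_states (B : finType) (n : nat) (H : {set B}) :
    {set {ffun 'I_n -> B}} :=
  [set X : {ffun 'I_n -> B} | [forall i, X i \in H]].

(* Main.v *)
Require Import Defs.
From mathcomp Require Import all_boot.

(* A subuniverse is closed under every term operation.  Hence one step of the
   dynamics preserves H^n as soon as the controls also lie in H, and a constant
   control with value in the nonempty set H suffices. *)

(** Structural induction on [e]; nullary operators fall under closure with a vacuous premise. [W] is
    arbitrary so as to cover both ['I_n] and ['I_n + 'I_m]. *)
Lemma eval_closed (B : finType) (s : nat) (ar : 'I_s -> nat)
    (t : forall i : 'I_s, {ffun 'I_(ar i) -> B} -> B)
    (H : {set B}) (hH : bearing_subspace t H)
    (W : Type) (x : W -> B) (hx : forall w, x w \in H) (e : term ar W) :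
  eval t x e \in H.
Proof.
elim: e => [w | i args IH] /=; first exact: hx.
by case: hH => _; apply=> j; rewrite ffunE.
Qed.

Lemma restricted_statesP (B : finType) (n : nat) (H : {set B})
    (X : {ffun 'I_n -> B}) :
  reflect (forall i, X i \in H) (X \in restricted_states n H).
Proof. by rewrite inE; apply: forallP. Qed.

Theorem proposition23 (B : finType) (k : nat) (hk : 2 <= k) (hB : #|B| = k)
    (s : nat) (ar : 'I_s -> nat)
    (t : forall i : 'I_s, {ffun 'I_(ar i) -> B} -> B)
    (H : {set B}) (hH : bearing_subspace t H)
    (n m : nat) (hn : 1 <= n) (hm : 1 <= m) :
  (forall f : 'I_n -> {ffun 'I_n -> B} -> B,
      network_has_bearing_space t f ->
      state_invariant f (restricted_states n H)) /\
  (forall f : 'I_n -> {ffun 'I_n -> B} -> {ffun 'I_m -> B} -> B,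
      control_network_has_bearing_space t f ->
      state_control_invariant f (restricted_states n H)).
Proof.
split=> f hf X0 hX0.
  elim=> [|T /restricted_statesP IH] //=.
  apply/restricted_statesP=> i; rewrite ffunE.
  by have [e ->] := hf i; apply: eval_closed.
have [/set0Pn [h hh] _] := hH.
(* This control depends neither on [X0] nor on [f]. *)
exists (fun=> [ffun=> h]).
elim=> [|T /restricted_statesP IH] //=.
apply/restricted_statesP=> i; rewrite ffunE.
(* State variables of [e] take values in [H] by induction on time, control variables by the choice
   of [h]. *)
have [e ->] := hf i; apply: eval_closed => // -[j | l]; first exact: IH.
by rewrite ffunE.
Qed.
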